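(* Bicrucial permutations with respect to squares of even length exist, and the shortest such permutation of even length has length $32$.
   Context: Permutations are written in one-line notation. A factor is a sequence of consecutive entries; two sequences of distinct numbers of equal length are order-isomorphic if their entries are in the same relative order. A square is a factor $XY$ with $X,Y$ consecutive, of equal length at least $2$, and order-isomorphic. A permutation is square-free if it contains no square. For $\pi=\pi_1\cdots\pi_n$, $x\in\{1,\dots,n+1\}$ and $i\in\{0,\dots,n\}$, the extension of $\pi$ by $x$ in position $i$ is $\pi'_1\cdots\pi'_i\,x\,\pi'_{i+1}\cdots\pi'_n$, where $\pi'_j=\pi_j$ if $\pi_j<x$ and $\pi'_j=\pi_j+1$ otherwise; $i=0$ gives an extension to the left and $i=n$ an extension to the right. A permutation is bicrucial with respect to squares if it is square-free but every extension of it to the left and every extension of it to the right (by any element) contains a square. *)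

(* Defs.v *)
From mathcomp Require Import all_boot all_fingroup.

Set Implicit Arguments.
Unset Strict Implicit.
Unset Printing Implicit Defensive.

(* 'S_n permutes {0, .., n-1}; the successor shifts its entries to {1, .., n}. *)
Definition one_line (n : nat) (p : 'S_n) : seq nat :=
  [seq (nat_of_ord (p i)).+1 | i <- enum 'I_n].

(* Only meaningful for sequences of pairwise distinct numbers. *)
Definition order_isomorphic (X Y : seq nat) : Prop :=
  size X = size Y /\
  forall i j : nat, i < size X -> j < size X ->
    (nth 0 X i < nth 0 X j) = (nth 0 Y i < nth 0 Y j).

Definition is_square (X Y : seq nat) : Prop :=
  2 <= size X /\ order_isomorphic X Y.

Definition contains_square (s : seq nat) : Prop :=
  exists X Y : seq nat, infix (X ++ Y) s /\ is_square X Y.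

Definition square_free (s : seq nat) : Prop := ~ contains_square s.

Definition extension (x i : nat) (s : seq nat) : seq nat :=
  let s' := [seq if y < x then y else y.+1 | y <- s] in
  take i s' ++ x :: drop i s'.

Definition bicrucial (n : nat) (p : 'S_n) : Prop :=
  [/\ square_free (one_line p),
      forall x : nat, 1 <= x <= n.+1 ->
        contains_square (extension x 0 (one_line p))
    & forall x : nat, 1 <= x <= n.+1 ->
        contains_square (extension x n (one_line p))].

(* Main.v *)
Require Import Defs.
From mathcomp Require Import all_boot all_fingroup.
From mathcomp Require Import zify.

Set Implicit Arguments.
Unset Strict Implicit.
Unset Printing Implicit Defensive.

(**
  In a square-free sequence two adjacent entries are never ordered like the two
  that follow them, so ascents and descents form a factor of the periodic word
  ++--++--.  When the length is even, exactly one end shows two equal signs; up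
  to reversal it is the left end, [v0 < v1 < v2] or [v0 > v1 > v2].  A square
  created there by an extension that continues the sign pattern has halves of
  length divisible by 4.  Extending by values in the three gaps bounded by
  [v0], [v1], [v2] gives pairwise distinct patterns of the first four entries,
  so the three half-lengths are distinct.  If the length is at most 30, then
  they must be 4, 8 and 12; but the square of half-length 8 forces those of
  half-lengths 4 and 12 to induce the same pattern, a contradiction.  The
  permutation of length 32 was found by a SAT search that prescribed squares of
  half-lengths 4, 8, 16 at one end and 4 at the other.
*)

(** * Squares by position, under reversal and under left extension *)

Definition square_at (s : seq nat) (i k : nat) : Prop :=
  forall a b, a < k -> b < k ->
    (nth 0 s (i + a) < nth 0 s (i + b)) =
    (nth 0 s (i + k + a) < nth 0 s (i + k + b)).

Lemma contains_squareP (s : seq nat) :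
  contains_square s <->
  exists i k, [/\ 2 <= k, i + k + k <= size s & square_at s i k].
Proof.
split=> [[X [Y [XYs [X2 [XY iso]]]]] | [i [k [k2 ik sq]]]].
  have [p [q ->]] : exists p q : seq nat, s = p ++ (X ++ Y) ++ q.
    by apply/infixP.
  exists (size p), (size X); split=> //; first by rewrite !size_cat -XY; lia.
  have nth_pref (r t : seq nat) a : nth 0 (r ++ t) (size r + a) = nth 0 t a.
    by rewrite nth_cat ltnNge leq_addr addKn.
  move=> a b aX bX; rewrite -!addnA !nth_pref -!catA !nth_pref.
  by rewrite !nth_cat -!XY aX bX; apply: iso.
have sX : size (take k (drop i s)) = k by rewrite size_takel // size_drop; lia.
have sY : size (take k (drop (i + k) s)) = k.
  by rewrite size_takel // size_drop; lia.
exists (take k (drop i s)), (take k (drop (i + k) s)); split; last first.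
  split; rewrite /order_isomorphic ?sX ?sY //; split=> // a b ak bk.
  by rewrite !nth_take // !nth_drop; apply: sq.
apply/infixP; exists (take i s), (drop (i + k + k) s).
have dropk m : drop (m + k) s = drop k (drop m s) by rewrite drop_drop addnC.
by rewrite -catA (dropk (i + k)) cat_take_drop dropk !cat_take_drop.
Qed.

Lemma contains_square_rev (s : seq nat) :
  contains_square s -> contains_square (rev s).
Proof.
case=> X [Y [XYs [X2 [XY iso]]]]; exists (rev Y), (rev X); split.
  by rewrite -rev_cat infix_rev.
split; rewrite /order_isomorphic !size_rev -?XY //; split=> // i j iX jX.
by rewrite !nth_rev -?XY //; symmetry; apply: iso; lia.
Qed.

Lemma extension_rev (x : nat) (s : seq nat) :
  extension x (size s) s = rev (extension x 0 (rev s)).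
Proof.
rewrite /extension take0 drop0 rev_cons map_rev revK.
by rewrite -(size_map (fun y => if y < x then y else y.+1) s) take_size
  drop_size cats1.
Qed.

(** As [s] is square-free, the square must start at the new entry. Its halves are [x] with the first
    [k.-1] entries of [s], and the next [k] entries of [s]; thus position [k.-1] of [s] plays the
    role of [x]. *)
Lemma left_extension_square (s : seq nat) (x : nat) :
  square_free s -> contains_square (extension x 0 s) ->
  exists k, [/\ 2 <= k, k + k <= (size s).+1,
    forall a b, a < k.-1 -> b < k.-1 ->
      (nth 0 s a < nth 0 s b) = (nth 0 s (k + a) < nth 0 s (k + b)) &
    forall a, a < k.-1 ->
      (nth 0 s a < x) = (nth 0 s (k + a) < nth 0 s k.-1)].
Proof.
move=> sqf /contains_squareP[i [k []]].
rewrite /extension take0 drop0 /=; set f := fun y => _; rewrite size_map.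
have ltf y z : (f y < f z) = (y < z).
  by rewrite /f; case: ifP; case: ifP; lia.
have ltx y : (f y < x) = (y < x) by rewrite /f; case: ifP; lia.
have ltfs a b : a < size s -> b < size s ->
    (nth 0 (map f s) a < nth 0 (map f s) b) = (nth 0 s a < nth 0 s b).
  by move=> la lb; rewrite !(nth_map 0) // ltf.
case: i => [|i] k2 ik sq.
  exists k; split=> // [a b ak bk|a ak].
    by have := sq a.+1 b.+1; rewrite !add0n !addnS /= !ltfs; lia.
  have := sq a.+1 0; rewrite !add0n addnS addn0 /= => sq'.
  rewrite -ltx -(nth_map 0 0 f) ?sq'; try lia.
  by case: k k2 {sq sq'} ik ak => // k _ ik ak /=; rewrite ltfs; lia.
case: sqf; apply/contains_squareP; exists i, k; split=> // a b ak bk.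
by have := sq a b ak bk; rewrite !addSn /= !ltfs //; lia.
Qed.

(** * The sign pattern of a square-free sequence *)

Definition ascent (s : seq nat) (i : nat) : bool := nth 0 s i < nth 0 s i.+1.

Lemma nth_ltC (s : seq nat) (a b : nat) :
  uniq s -> a < size s -> b < size s -> a != b ->
  (nth 0 s a < nth 0 s b) = ~~ (nth 0 s b < nth 0 s a).
Proof.
by move=> us la lb ab; rewrite -leqNgt ltn_neqAle nth_uniq // ab.
Qed.

Lemma square_free_ascent (s : seq nat) (i : nat) :
  uniq s -> square_free s -> i + 3 < size s -> ascent s i.+2 = ~~ ascent s i.
Proof.
move=> us sqf il.
case: (boolP (ascent s i.+2 == ~~ ascent s i)) => [/eqP //|neq].
case: sqf; apply/contains_squareP; exists i, 2; split=> //; first by lia.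
have E : (nth 0 s i < nth 0 s i.+1) = (nth 0 s i.+2 < nth 0 s i.+3).
  by move: neq; rewrite /ascent; do 2 case: (_ < _).
move=> [|[|a]] [|[|b]] // _ _; rewrite ?addn2 ?addn1 ?addn0 ?ltnn //=.
by rewrite nth_ltC ?[RHS]nth_ltC ?E; lia.
Qed.

Lemma ascent_odd (s : seq nat) (i : nat) :
  uniq s -> square_free s -> i.+1 < size s ->
  ascent s i = ascent s (odd i) (+) odd i./2.
Proof.
move=> us sqf; have [n] := ubnP i; elim: n i => // n IHn [|[|i]] lin il.
- by rewrite addbF.
- by rewrite addbF.
have -> : ascent s i.+2 = ~~ ascent s i.
  by apply: square_free_ascent => //; rewrite addn3.
rewrite (IHn i (ltnW lin)); last exact: ltn_trans il.
by rewrite /= negbK addbN.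
Qed.

(* The hypotheses on [k] are those supplied by [left_extension_square]; the
   condition on [x] says that [x] continues the sign pattern. *)
Lemma half_length_dvd4 (s : seq nat) (x k : nat) :
  uniq s -> square_free s -> ascent s 0 = ascent s 1 ->
  2 <= k -> k + k <= (size s).+1 ->
  (forall a b, a < k.-1 -> b < k.-1 ->
     (nth 0 s a < nth 0 s b) = (nth 0 s (k + a) < nth 0 s (k + b))) ->
  (nth 0 s 0 < x) = (nth 0 s (k + 0) < nth 0 s k.-1) ->
  (nth 0 s 0 < x) = ascent s 0 -> 4 %| k.
Proof.
move=> us sqf eq01 k2 ks P1 P2 xE.
(* The first sign of the second half makes [k.-1./2] odd, which excludes [k = 2]; its second sign
   then makes [k./2] even. *)
have ak1 : ascent s k.-1 = ~~ ascent s 0.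
  rewrite -xE P2 /ascent addn0 prednK; last by clear - k2; lia.
  by rewrite nth_ltC ?negbK //; clear - k2 ks; lia.
have ak : 2 < k -> ascent s k = ascent s 0.
  by move=> k3; have := P1 0 1; rewrite /ascent addn0 addn1 => ->;
    clear - k3; lia.
have aE i : i.+1 < size s -> ascent s i = ascent s 0 (+) odd i./2.
  by move=> il; rewrite ascent_odd //; case: (odd i); rewrite -?eq01.
have k1s : k.-1.+1 < size s by clear - k2 ks; lia.
rewrite aE // in ak1.
have {}ak : 2 < k -> ascent s 0 (+) odd k./2 = ascent s 0.
  by move=> k3; rewrite -aE ?ak //; clear - k3 ks; lia.
by move: ak1 ak; clear - k2; case: (ascent s 0) => /=; lia.
Qed.

(** * The lower bound on the length *)

Lemma bicrucial_left_size (s : seq nat) :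
  uniq s -> square_free s -> ascent s 0 = ascent s 1 ->
  (forall y, y \in s -> 1 <= y <= size s) ->
  (forall x, 1 <= x <= (size s).+1 -> contains_square (extension x 0 s)) ->
  31 <= size s.
Proof.
move=> us sqf eq01 sn ext; rewrite leqNgt; apply/negP=> s31.
have s3 : 2 < size s.
  have [k [k2 ks _ _]] := left_extension_square sqf (ext 1 isT).
  by clear - k2 ks; lia.
(* [pattern x] compares the first entry of a square with the next three, and [row k] does so in its
   second half. *)
pose row k := [:: nth 0 s (k + 0) < nth 0 s k.-1;
  nth 0 s (k + 1) < nth 0 s k.-1; nth 0 s (k + 2) < nth 0 s k.-1].
pose pattern x := [:: nth 0 s 0 < x; nth 0 s 1 < x; nth 0 s 2 < x].
have key x : 1 <= x <= (size s).+1 -> (nth 0 s 0 < x) = ascent s 0 ->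
    exists k, [/\ k \in [:: 4; 8; 12], pattern x = row k &
                  k = 8 -> row 4 = row 12].
  move=> xs xE; have [k [k2 ks P1 P2]] := left_extension_square sqf (ext x xs).
  have k4 : 4 %| k.
    apply: (half_length_dvd4 us sqf eq01 k2 ks P1) xE.
    by apply: P2; clear - k2; lia.
  have {}k2 : 2 < k.-1 by clear - k4 k2; lia.
  (* Here [k + k <= 31]. *)
  exists k; split; first by rewrite !inE; clear - k4 k2 ks s31; lia.
    by rewrite /row -!P2 //; clear - k2; lia.
  (* Half-length 8 matches positions 3 to 6 with 11 to 14, the ones read by [row 4] and [row 12]. *)
  move=> k8; rewrite k8 in P1.
  exact: (f_equal3 (fun t u v => [:: t; u; v])
    (P1 4 3 isT isT) (P1 5 3 isT isT) (P1 6 3 isT isT)).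
have no_three x y z :
    1 <= x <= (size s).+1 -> (nth 0 s 0 < x) = ascent s 0 ->
    1 <= y <= (size s).+1 -> (nth 0 s 0 < y) = ascent s 0 ->
    1 <= z <= (size s).+1 -> (nth 0 s 0 < z) = ascent s 0 ->
    pattern x <> pattern y -> pattern x <> pattern z ->
    pattern y <> pattern z -> False.
  move=> xs xE ys yE zs zE.
  have [k [k_in -> k8]] := key x xs xE; have [l [l_in -> l8]] := key y ys yE.
  have [m [m_in -> m8]] := key z zs zE.
  move: k_in l_in m_in k8 l8 m8; rewrite !inE.
  move=> /or3P[]/eqP-> /or3P[]/eqP-> /or3P[]/eqP-> k8 l8 m8;
    first [have := k8 erefl | have := l8 erefl | have := m8 erefl | idtac];
    congruence.
have bounds i : i < 3 -> 1 <= nth 0 s i <= size s.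
  by move=> i3; apply/sn/mem_nth/(leq_trans i3).
have := bounds 0 isT; have := bounds 1 isT; have := bounds 2 isT.
have := @nth_ltC s 0 1 us; have := @nth_ltC s 1 2 us.
move: eq01 no_three; rewrite /pattern /ascent; clear - s3.
move: (nth 0 s 0) (nth 0 s 1) (nth 0 s 2) => a b c.
have [lt_ab|le_ba] := ltnP a b => ab_bc no_three bc ab cb bb ab_bounds.
  (* Inserting [v.+1] lands just above an entry [v], inserting [v] just below it; this keeps [x] on
     the prescribed side of the first entry. *)
  by apply: (no_three a.+1 b.+1 c.+1); try lia; case; lia.
by apply: (no_three a b c); try lia; case; lia.
Qed.

(** The last two signs sit at an odd and then an even position, whose halves differ by one. So they
    agree when the first two differ, and reversal negates both. *)
Lemma even_ascent_rev (s : seq nat) :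
  uniq s -> square_free s -> 2 < size s -> ~~ odd (size s) ->
  ascent s 0 <> ascent s 1 -> ascent (rev s) 0 = ascent (rev s) 1.
Proof.
move=> us sqf s3 es neq01; rewrite /ascent !nth_rev //; try by clear - s3; lia.
rewrite nth_ltC ?[RHS]nth_ltC //; try by clear - s3; lia.
have := @ascent_odd s (size s - 2) us sqf.
have := @ascent_odd s (size s - 3) us sqf.
rewrite /ascent.
have -> : (size s - 3).+1 = size s - 2 by clear - s3; lia.
have -> : (size s - 2).+1 = size s - 1 by clear - s3; lia.
have -> : odd (size s - 3) = true by clear - s3 es; lia.
have -> : odd (size s - 2) = false by clear - s3 es; lia.
have -> : odd (size s - 3)./2 = ~~ odd (size s - 2)./2 by clear - s3 es; lia.
move=> -> ; last by clear - s3; lia.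
move=> -> ; last by clear - s3; lia.
by move: neq01; rewrite /ascent /=; do 2 case: (_ < _) => //; case: odd.
Qed.

Lemma even_bicrucial_size (s : seq nat) :
  uniq s -> square_free s -> ~~ odd (size s) ->
  (forall y, y \in s -> 1 <= y <= size s) ->
  (forall x, 1 <= x <= (size s).+1 -> contains_square (extension x 0 s)) ->
  (forall x, 1 <= x <= (size s).+1 ->
    contains_square (extension x (size s) s)) ->
  32 <= size s.
Proof.
move=> us sqf es mem extl extr; suff : 31 <= size s by clear - es; lia.
have [eq01|/eqP neq01] := eqVneq (ascent s 0) (ascent s 1).
  exact: bicrucial_left_size us sqf eq01 mem extl.
have s3 : 2 < size s.
  have [k [k2 ks _ _]] := left_extension_square sqf (extl 1 isT).
  by clear - k2 ks; lia.
rewrite -size_rev; apply: bicrucial_left_size.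
- by rewrite rev_uniq.
- by move=> /contains_square_rev; rewrite revK.
- exact: even_ascent_rev.
- by move=> y; rewrite mem_rev size_rev; apply: mem.
- move=> x; rewrite size_rev => xs.
  rewrite -[extension _ _ _]revK -extension_rev.
  exact/contains_square_rev/extr.
Qed.

(** * Computation with the witness of length 32 *)

(** Meant for [vm_compute], which is call-by-value: the conditional skips all comparisons when the
    two halves overrun the sequence. *)
Definition has_square (s : seq nat) : bool :=
  has (fun i => has (fun k =>
    if i + k + k <= size s then
      all (fun a => all (fun b =>
        (nth 0 s (i + a) < nth 0 s (i + b)) ==
        (nth 0 s (i + k + a) < nth 0 s (i + k + b))) (iota 0 k)) (iota 0 k)
    else false) (iota 2 (size s)./2)) (iota 0 (size s)).

Lemma has_squareP (s : seq nat) : reflect (contains_square s) (has_square s).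
Proof.
apply: (iffP hasP) => [[i _ /hasP[k]] | /contains_squareP[i [k [k2 ik sq]]]].
  rewrite mem_iota; case: ifP => // ik /andP[k2 _] /allP sq.
  apply/contains_squareP; exists i, k; split=> // a b ak bk.
  have a_in : a \in iota 0 k by rewrite mem_iota.
  by have /allP/(_ b) := sq a a_in; rewrite mem_iota bk => /(_ isT)/eqP.
exists i; first by rewrite mem_iota; clear - k2 ik; lia.
apply/hasP; exists k; first by rewrite mem_iota; clear - k2 ik; lia.
rewrite ik; apply/allP => a; rewrite mem_iota => /andP[_ ak].
by apply/allP => b; rewrite mem_iota => /andP[_ bk]; apply/eqP/sq.
Qed.

Lemma one_line_uniq (n : nat) (p : 'S_n) : uniq (one_line p).
Proof.
rewrite map_inj_uniq ?enum_uniq // => i j [ij].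
exact/(@perm_inj _ p)/val_inj.
Qed.

Lemma size_one_line (n : nat) (p : 'S_n) : size (one_line p) = n.
Proof. by rewrite size_map size_enum_ord. Qed.

Lemma mem_one_line (n : nat) (p : 'S_n) (y : nat) :
  y \in one_line p -> 1 <= y <= n.
Proof. by case/mapP=> i _ ->; exact: ltn_ord. Qed.

Definition witness : seq nat :=
  [:: 4; 10; 7; 3; 6; 19; 11; 8; 15; 16; 12; 5; 9; 20; 18; 14; 21; 24; 17; 1;
      13; 31; 25; 22; 28; 29; 26; 2; 23; 32; 30; 27].

Lemma witness_one_line : exists p : 'S_32, one_line p = witness.
Proof.
(* The predecessor undoes the shift in [one_line]; [wb] keeps [inord] away from its default
   value. *)
pose f (i : 'I_32) : 'I_32 := inord (nth 0 witness i).-1.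
have wb i : i < 32 -> 1 <= nth 0 witness i <= 32.
  have /allP h : all (fun y => 1 <= y <= 32) witness by [].
  by move=> i32; apply/h/mem_nth.
have fE i : (val (f i)).+1 = nth 0 witness i.
  have /andP[w1 w32] := wb i (ltn_ord i).
  by rewrite /= inordK ?prednK.
have f_inj : injective f.
  move=> i j /(congr1 (fun x => (val x).+1)); rewrite !fE => /eqP.
  by rewrite nth_uniq ?ltn_ord // => /eqP/val_inj.
exists (perm f_inj).
rewrite /one_line (eq_map (g := nth 0 witness \o val)) => [|i].
  by rewrite map_comp val_enum_ord.
by rewrite permE fE.
Qed.

Theorem theorem6 :
  (exists p : 'S_32, bicrucial p) /\
  (forall (n : nat) (p : 'S_n), ~~ odd n -> bicrucial p -> 32 <= n).
Proof.
split; last first.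
  move=> n p en [sqf extl extr]; rewrite -(size_one_line p).
  apply: even_bicrucial_size; rewrite ?size_one_line //.
    exact: one_line_uniq.
  exact: mem_one_line.
have [p pE] := witness_one_line; exists p; rewrite /bicrucial pE.
have ext_square i :
    all (fun x => has_square (extension x i witness)) (iota 1 33) ->
    forall x, 1 <= x <= 33 -> contains_square (extension x i witness).
  by move=> /allP sq x xs; apply/has_squareP/sq; rewrite mem_iota.
split; last by apply: ext_square; vm_compute.
  by apply/has_squareP; vm_compute.
by apply: ext_square; vm_compute.
Qed.
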